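(* Let $G(n,p)$ be an Erdős–Rényi random graph with $p=\lambda/n$, where $\lambda=\lambda_n>1$ remains bounded away from $1$ as $n\to\infty$. Fix an integer $m\ge1$ and assume $\lambda=o(n^{1/(2m+2)})$. Let $C_{\mathrm{giant}}$ be the largest connected component of $G(n,p)$ and $\operatorname{Core}_2(C_{\mathrm{giant}})$ its $2$-core. Then $$\lim_{n\to\infty}\mathbb{P}\bigl(\operatorname{Core}_2(C_{\mathrm{giant}})\text{ admits a switching of size}\le m\text{ that yields a graph not isomorphic to }\operatorname{Core}_2(C_{\mathrm{giant}})\bigr)=0,$$ i.e. with probability tending to one, every graph obtainable from $\operatorname{Core}_2(C_{\mathrm{giant}})$ by a switching of size at most $m$ is isomorphic to it.
   Context: Graphs are finite and simple. The $2$-core of a graph is the subgraph that remains after iteratively removing all vertices of degree less than $2$. Switching of size $\le m$: given a graph $G$ on $N\ge m$ vertices, a graph $H$ is obtained from $G$ by a switching of size $\le m$ if there exist orderings of the vertices of $G$ and $H$ such that their adjacency matrices satisfy $A_H=(Q\oplus I_{N-m})^{T}A_G(Q\oplus I_{N-m})$ for some $m\times m$ real orthogonal matrix $Q$ that is not a permutation matrix, where $I_{N-m}$ is the identity matrix and $\oplus$ denotes block-diagonal sum. In $G(n,p)$ each possible edge is present independently with probability $p$. *)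

(* Defs.v *)
From HB Require Import structures.
From mathcomp Require Import all_boot all_order all_algebra all_fingroup.
From mathcomp Require Import all_classical all_reals all_analysis.
Set Implicit Arguments. Unset Strict Implicit. Unset Printing Implicit Defensive.
Import Order.TTheory GRing.Theory Num.Theory.
Local Open Scope ring_scope.

(* A simple graph on vertex set 'I_n is encoded by its edge set D:
   a set of pairs (i,j) with i < j (each unordered edge exactly once). *)
Definition simple_edges n (D : {set 'I_n * 'I_n}) : bool :=
  [forall x in D, (x.1 < x.2)%N].

Definition adj n (D : {set 'I_n * 'I_n}) : rel 'I_n :=
  fun i j => ((i, j) \in D) || ((j, i) \in D).

Definition is_component n (D : {set 'I_n * 'I_n}) (C : {set 'I_n}) : bool :=
  [exists v, C == [set u | connect (adj D) v u]].

Definition largest_component n (D : {set 'I_n * 'I_n}) (C : {set 'I_n}) : bool :=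
  is_component D C &&
  [forall C' : {set 'I_n}, is_component D C' ==> (#|C'| <= #|C|)%N].

Definition core_step n (D : {set 'I_n * 'I_n}) (S : {set 'I_n}) : {set 'I_n} :=
  [set v in S | (1 < #|[set u in S | adj D v u]|)%N].

(* 2-core of the induced subgraph on S: iterate the peeling (|S| rounds
   suffice, since each non-stationary round removes a vertex) *)
Definition core2 n (D : {set 'I_n * 'I_n}) (S : {set 'I_n}) : {set 'I_n} :=
  iter #|S| (core_step D) S.

Definition adjmx (R : realType) (T : finType) (e : rel T) N (s : 'I_N -> T)
  : 'M[R]_N := \matrix_(i, j) (e (s i) (s j))%:R.

Definition simple_adjmx (R : realType) N (M : 'M[R]_N) : Prop :=
  forall i j, (M i j = 0 \/ M i j = 1) /\ M i j = M j i /\ (i = j -> M i j = 0).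

Definition iso_adjmx (R : realType) N (A M : 'M[R]_N) : Prop :=
  exists s : 'S_N, forall i j, M i j = A (s i) (s j).

Definition real_orthogonal (R : realType) m (Q : 'M[R]_m) : Prop :=
  Q^T *m Q = 1%:M.

Definition switch_mx (R : realType) m k (Q : 'M[R]_m) (A : 'M[R]_(m + k))
  : 'M[R]_(m + k) :=
  (block_mx Q 0 0 1%:M)^T *m A *m block_mx Q 0 0 1%:M.

(* The induced subgraph of (T, e) on the vertex set K admits a switching of
   size <= m producing a graph H not isomorphic to it: |K| = N = m + k >= m,
   s is an ordering of K, Q an m x m real orthogonal non-permutation matrix,
   and (Q (+) I_k)^T A (Q (+) I_k) is the adjacency matrix of a simple graph H
   (under some ordering of H) which is not isomorphic to the induced graph. *)
Definition nonisomorphic_switching (R : realType) (m : nat) (T : finType)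
  (e : rel T) (K : {set T}) : Prop :=
  exists (k : nat) (s : 'I_(m + k) -> T),
    [/\ injective s, (forall i, s i \in K) & #|K| = (m + k)%N] /\
    exists Q : 'M[R]_m,
      [/\ real_orthogonal Q, ~~ is_perm_mx Q,
        simple_adjmx (switch_mx Q (adjmx R e s))
        & ~ iso_adjmx (adjmx R e s) (switch_mx Q (adjmx R e s))].

Definition bad_event (R : realType) (m n : nat) (D : {set 'I_n * 'I_n}) : Prop :=
  exists C : {set 'I_n},
    largest_component D C /\ nonisomorphic_switching R m (adj D) (core2 D C).

Definition Gnp_prob (R : realType) (n : nat) (p : R)
  (E : {set 'I_n * 'I_n} -> Prop) : R :=
  \sum_(D : {set 'I_n * 'I_n} | simple_edges D && `[< E D >])
     p ^+ #|D| * (1 - p) ^+ ('C(n, 2) - #|D|).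

Arguments Gnp_prob {R} n p E.
Arguments bad_event R m n D : clear implicits.

(* Main.v *)
Require Import Defs.
From HB Require Import structures.
From mathcomp Require Import all_boot all_order all_algebra all_fingroup.
From mathcomp Require Import zify ring.
Set Implicit Arguments. Unset Strict Implicit. Unset Printing Implicit Defensive.
Import Order.TTheory GRing.Theory Num.Theory.

(** A first moment bound shows that, with probability tending to one, no set of
    at most 2m+1 vertices spans more edges than it has vertices; the exponent
    1/(2m+2) is what the case of 2m+1 vertices and 2m+2 edges requires. On this
    event no switching of size at most m of an induced subgraph of minimum
    degree 2 can change its isomorphism type, and the giant component plays no
    role.

    Up to a permutation, let Q be the identity off a set I of at most m indices
    whose rows in Q are not standard basis vectors. A vertex off I cannot have
    exactly one neighbour in I. Counting edges, the set U of all vertices in I or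
    adjacent to I induces a 2-regular graph, and so does the switched graph on U,
    because 2 is the largest eigenvalue and the number of edges is preserved.
    Write the two unions of cycles as P + P^-1 for permutation matrices P.
    Conjugation by Q is compatible with Chebyshev polynomials, hence
    P^k + P^-k has in both graphs the same entries off I and the same trace, for
    every k. The entries determine the position of the vertices of U off I on
    their cycles, up to reflection, and the traces determine the lengths of the
    other cycles. So an isomorphism fixing every vertex off I exists on U, and it
    extends by the identity. *)

(** * Two-regular graphs as permutations *)

Lemma sum_pred1 (T : finType) (v : T) : \sum_u (u == v) = 1.
Proof. by rewrite (bigD1 v) //= eqxx big1 // => u /negPf ->. Qed.

Lemma sum_eq2 (T : finType) (F : T -> nat) : \sum_v F v = 2 ->
  exists v v', forall y, F y = (y == v) + (y == v').
Proof.
move=> F2.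
have [v Fv] : exists v, 0 < F v.
  apply/existsP; apply: contra_eqT F2; rewrite negb_exists => /forallP F0.
  by rewrite big1 // => v _; move: (F0 v); case: (F v).
pose G u := F u - (u == v).
have FG u : F u = (u == v) + G u by rewrite /G; case: eqP => [->|]; lia.
have /eqP/sum_nat_eq1 [v' [_ Gv' G0]] : \sum_u G u = 1.
  by move: F2; rewrite (eq_bigr _ (fun u _ => FG u)) big_split /= sum_pred1 => -[].
exists v, v' => y; rewrite FG; congr (_ + _).
by have [->//|ne] := eqVneq y v'; rewrite G0.
Qed.

(** Induction on the number of vertices without a loop: one such vertex at a time is cut out of its
    cycle. A loop counts 2 on the diagonal and gives a fixed point of [a]; a double edge gives a
    2-cycle. *)
Lemma two_regular_perm (T : finType) (M : T -> T -> nat) :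
  (forall u v, M u v = M v u) -> (forall u, \sum_v M u v = 2) ->
  (forall u, M u u != 1) ->
  exists a : {perm T}, forall u v, M u v = (v == a u) + (u == a v).
Proof.
have [n] := ubnP #|[set u | M u u != 2]|; elim: n M => // n IHn M cardM symM sumM M1.
have [/set0Pn [u] | /negPn/eqP M2] := boolP ([set u | M u u != 2] != set0); last first.
  have Muu u : M u u = 2.
    by apply/eqP/negPn/negP => ne; move/setP/(_ u): M2; rewrite !inE ne.
  exists 1%g => u v; rewrite !perm1; have [->|ne] := eqVneq v u.
    by rewrite Muu.
  by move: (sumM u); rewrite (bigD1 u) //= Muu (bigD1 v) //=; lia.
rewrite inE => Muu2.
have Muu : M u u = 0.
  move: (sumM u) (M1 u) Muu2; rewrite (bigD1 u) //=; case: (M u u) => [|[|[|k]]] //.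
have [v [v' Mu]] := sum_eq2 (sumM u).
have vu : v != u by apply/eqP => e; move: (Mu u); rewrite Muu e eqxx.
have v'u : v' != u by apply/eqP => e; move: (Mu u); rewrite Muu e eqxx; lia.
(* Remove [u] and join its two neighbours [v], [v'] by a new edge. *)
pose M' x y := if (x == u) || (y == u) then ((x == u) && (y == u)).*2
  else M x y + ((x == v) && (y == v')) + ((x == v') && (y == v)).
have M'E x y : x != u -> y != u ->
    M' x y = M x y + ((x == v) && (y == v')) + ((x == v') && (y == v)).
  by rewrite /M' => /negPf -> /negPf ->.
have [|||w|a aP] := IHn M'.
- apply: leq_trans (_ : _ <= #|[set x | M x x != 2] |) _; last by rewrite -ltnS.
  apply: proper_card; apply/properP; split.
    apply/subsetP => x; rewrite !inE; have [->|xu] := eqVneq x u.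
      by rewrite /M' eqxx.
    rewrite M'E //; apply: contraNN => /eqP Mx.
    suff [/negPf -> /negPf ->] : x != v /\ x != v' by rewrite Mx.
    move: (sumM x); rewrite (bigD1 x) //= Mx (bigD1 u) 1?(eq_sym u) //= symM Mu.
    move=> /(congr1 (subn^~ 2)) /eqP; rewrite addKn !addn_eq0 !eqb0.
    by case/andP=> /andP[].
  by exists u; rewrite !inE /M' ?eqxx // Muu2.
- move=> x y; rewrite /M' orbC [(x == u) && _]andbC symM; case: ifP => // _.
  by rewrite -addnA [X in _ + X = _]addnC addnA [(x == v) && _]andbC [(x == v') && _]andbC.
- move=> x; rewrite (bigD1 u) //=; have [->|xu] := eqVneq x u.
    rewrite /M' !eqxx /= big1 // => y /negPf yu.
    by rewrite yu /= .
  rewrite {1}/M' (negPf xu) eqxx /= (eq_bigr _ (fun y yu => M'E x y xu yu)).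
  rewrite add0n; move: (sumM x); rewrite (bigD1 u) //= symM Mu !big_split /=.
  have S b w : w != u -> \sum_(i | i != u) (b && (i == w)) = b.
    move=> wu; rewrite (bigD1 w) //= eqxx andbT big1 ?addn0 // => i /andP[_ /negPf ->].
    by rewrite andbF.
  by rewrite !S //; lia.
- have [->|wu] := eqVneq w u; first by rewrite /M' eqxx.
  rewrite M'E //; move: (M1 w).
  (* The diagonal entry grows by 0 or, when [v = v'], by 2. *)
  by have := andbC (w == v) (w == v'); case: (_ && _) => <-; lia.
have au : a u = u.
  by move: (aP u u); rewrite /M' eqxx /=; case: (eqVneq u (a u)) => // _; lia.
(* Up to exchanging [v] and [v'], insert [u] between [v] and [v' = a v]. *)
have ins v1 v2 : (forall y, M u y = (y == v1) + (y == v2)) -> v1 != u -> v2 != u ->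
    (forall x y, x != u -> y != u ->
     M' x y = M x y + ((x == v1) && (y == v2)) + ((x == v2) && (y == v1))) ->
    a v1 = v2 ->
    exists a : {perm T}, forall u v, M u v = (v == a u) + (u == a v).
  move=> {}Mu v1u v2u {}M'E av1.
  pose b := (a * tperm u v2)%g.
  have bu : b u = v2 by rewrite permM au tpermL.
  have bE x : x != u -> b x = if x == v1 then u else a x.
    move=> xu; rewrite permM; have [->|xv] := eqVneq x v1; first by rewrite av1 tpermR.
    rewrite tpermD // eq_sym; first by rewrite -{1}au (inj_eq perm_inj).
    by rewrite -av1 (inj_eq perm_inj).
  have Eu y : M u y = (y == b u) + (u == b y).
    rewrite Mu bu addnC; congr (_ + _).
    have [->|yu] := eqVneq y u.
      by rewrite bu eq_sym (negPf v1u) eq_sym (negPf v2u).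
    rewrite bE //; case: eqVneq => [_|yv]; first by rewrite eqxx.
    by rewrite -{1}au (inj_eq perm_inj) eq_sym (negPf yu).
  exists b => x y; have [->//|xu] := eqVneq x u; have [->|yu] := eqVneq y u.
    by rewrite symM Eu addnC.
  move: (M'E x y xu yu); rewrite aP !bE //.
  have F1 w z : w != u -> z != u ->
      (w == a z : nat) = (w == if z == v1 then u else a z) + ((z == v1) && (w == v2)).
    move=> /negPf wu zu; case: (eqVneq z v1) => [->|_]; first by rewrite wu av1.
    by rewrite addn0.
  by rewrite (F1 y x) // (F1 x y) //; rewrite [(x == v2) && _]andbC; lia.
have : 0 < M' v v' by rewrite M'E // !eqxx; lia.
rewrite aP addn_gt0 !lt0b => /orP[/eqP|/eqP] av.
  by apply: (ins v v').
apply: (ins v' v) => // [y|x y xu yu]; first by rewrite Mu addnC.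
by rewrite M'E // addnAC.
Qed.

(** * Isomorphisms between unions of cycles that fix marked vertices *)

Section PartialIsomorphism.

Variables (T : finType) (a b : {perm T}) (W : {set T}).

(* The sign in [c = b \/ c = b^-1] lets each cycle be mapped with either
   orientation. *)
Definition partial_iso (S : {set T}) (f : T -> T) : Prop :=
  [/\ {in S, forall u, a u \in S},
      {in S &, injective f},
      {in S, forall u, exists2 c : {perm T}, c = b \/ c = b^-1%g &
         forall k, f ((a ^+ k)%g u) = (c ^+ k)%g (f u)},
      {in S, forall w, w \in W -> f w = w} &
      {in S, forall u, f u \in W -> f u \in S}].

(** [b] and its inverse generate the same finite cyclic group, in which every inverse is a power
    with a natural exponent. This avoids integer exponents throughout. *)
Lemma expg_sign_inv (c c' : {perm T}) j : c = b \/ c = b^-1%g ->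
  c' = b \/ c' = b^-1%g -> exists k, ((c ^+ j)^-1 = c' ^+ k)%g.
Proof.
have cyc (d : {perm T}) : d = b \/ d = b^-1%g -> <[d]>%g = <[b]>%g.
  by case=> -> //; rewrite cycleV.
move=> /cyc ec /cyc ec'; apply/cycleP.
by rewrite ec' -ec groupV groupX // cycle_id.
Qed.

Lemma expg_closed (S : {set T}) k u : {in S, forall u, a u \in S} ->
  u \in S -> (a ^+ k)%g u \in S.
Proof.
move=> Sa Su; elim: k => [|k IH]; first by rewrite expg0 perm1.
by rewrite expgSr permM Sa.
Qed.

Lemma eq_expg_perm (s : {perm T}) x i d :
  ((s ^+ i)%g x == (s ^+ (i + d))%g x) = ((s ^+ d)%g x == x).
Proof. by rewrite addnC expgD permM (inj_eq perm_inj) eq_sym. Qed.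

Lemma expgV_perm_eq (s : {perm T}) k x y :
  ((s^-1 ^+ k)%g x == y) = ((s ^+ k)%g y == x).
Proof.
rewrite expVgn; apply/eqP/eqP => <-; first by rewrite permKV.
by rewrite permK.
Qed.

Lemma porbit_closed (S : {set T}) u x : {in S, forall u, a u \in S} ->
  u \in S -> x \in porbit a u -> x \in S.
Proof. by move=> Sa Su /porbitP [k ->]; apply: expg_closed. Qed.

(** The cycle of [x] is sent to that of [y] by matching exponents, which is well defined and
    injective because the periods agree. It misses the image of [S] because that image is closed
    under [b] and its inverse. *)
Lemma partial_iso_extend S f x y c : partial_iso S f -> x \notin S ->
  {in S, forall u, f u != y} -> (c = b \/ c = b^-1%g) ->
  (forall j, ((a ^+ j)%g x == x) = ((c ^+ j)%g y == y)) ->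
  (forall j, (a ^+ j)%g x \in W -> (a ^+ j)%g x = (c ^+ j)%g y) ->
  (forall j, (c ^+ j)%g y \in W -> (c ^+ j)%g y \in porbit a x) ->
  exists f', partial_iso (S :|: porbit a x) f'.
Proof.
move=> [Sa Sinj Sf SW SfW] Sx Sy cb per Wx Wy.
have eqij i j : ((a ^+ i)%g x == (a ^+ j)%g x) = ((c ^+ i)%g y == (c ^+ j)%g y).
  wlog le_ij : i j / i <= j => [hw|].
    by case/orP: (leq_total i j) => le; [|rewrite eq_sym [RHS]eq_sym]; exact: hw.
  by rewrite -(subnKC le_ij) !eq_expg_perm per.
have disj u : u \in S -> u \notin porbit a x.
  move=> Su; apply: contraNN Sx; rewrite porbit_sym.
  exact: porbit_closed.
have cross u j : u \in S -> f u != (c ^+ j)%g y.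
  move=> Su; apply/eqP => fu.
  have [c' c'b c'f] := Sf u Su.
  have [k ck] := expg_sign_inv j cb c'b.
  have := Sy ((a ^+ k)%g u) (expg_closed k Sa Su).
  by rewrite c'f -ck fu permK eqxx.
pose f' u := if [pick j : 'I_#[a]%g | u == (a ^+ j)%g x] is Some j
  then (c ^+ j)%g y else f u.
have f'x j : f' ((a ^+ j)%g x) = (c ^+ j)%g y.
  rewrite /f'; case: pickP => [i|no].
    by rewrite eq_sym eqij => /eqP.
  have [i lti ei] := porbitPmin (mem_porbit a j x).
  by move: (no (Ordinal lti)); rewrite /= ei eqxx.
have f'S u : u \in S -> f' u = f u.
  move=> Su; rewrite /f'; case: pickP => // j /eqP eu.
  by move: (disj u Su); rewrite eu mem_porbit.
exists f'; split.
- move=> u; rewrite !inE => /orP[Su|/porbitP [k ->]]; first by rewrite Sa.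
  by rewrite -permM -expgSr mem_porbit orbT.
- move=> u v; rewrite !inE => /orP[Su|/porbitP [i ->]] /orP[Sv|/porbitP [j ->]].
  + by rewrite !f'S //; apply: Sinj.
  + by rewrite f'S // f'x => /eqP; rewrite (negPf (cross _ _ Su)).
  + by rewrite f'x f'S // => /esym/eqP; rewrite (negPf (cross _ _ Sv)).
  + by rewrite !f'x => /eqP; rewrite -eqij => /eqP.
- move=> u; rewrite !inE => /orP[Su|/porbitP [i ->]].
    have [c' c'b c'f] := Sf u Su; exists c' => // k.
    by rewrite !f'S // expg_closed.
  by exists c => // k; rewrite -permM -expgD !f'x -permM -expgD.
- move=> w; rewrite !inE => /orP[Sw|/porbitP [i ->]] Ww.
    by rewrite f'S // SW.
  by rewrite f'x Wx.
- move=> u; rewrite !inE => /orP[Su|/porbitP [i ->]].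
    by rewrite f'S // => Wu; rewrite SfW.
  by rewrite f'x => Wi; rewrite Wy // orbT.
Qed.

Lemma expg_fix_dvdn (s : {perm T}) x k : 0 < k -> (s ^+ k)%g x = x ->
  (forall j, 0 < j -> (s ^+ j)%g x = x -> k <= j) ->
  forall j, ((s ^+ j)%g x == x) = (k %| j).
Proof.
move=> k0 skx kmin j.
have mulk q : (s ^+ (q * k))%g x = x by rewrite mulnC expgM permX_fix.
rewrite {1}(divn_eq j k) expgD permM mulk /dvdn.
apply/eqP/eqP => [e|->]; last by rewrite expg0 perm1.
apply/eqP; apply: contraTT (ltn_pmod j k0); rewrite -lt0n -leqNgt => r0.
exact: kmin.
Qed.

(* Both sides count the directions in which [k] steps along the cycle of [w]
   lead to [w']. *)
Hypothesis pairW : forall k, {in W &, forall w w',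
  ((a ^+ k)%g w == w') + ((a ^+ k)%g w' == w) =
  ((b ^+ k)%g w == w') + ((b ^+ k)%g w' == w)}.
Hypothesis fixE : forall k,
  #|[set u | (a ^+ k)%g u == u]| = #|[set u | (b ^+ k)%g u == u]|.

Lemma pair_sign c k w w' : c = b \/ c = b^-1%g -> w \in W -> w' \in W ->
  ((a ^+ k)%g w == w') + ((a ^+ k)%g w' == w) =
  ((c ^+ k)%g w == w') + ((c ^+ k)%g w' == w).
Proof. by case=> -> Ww Ww'; rewrite pairW // !expgV_perm_eq addnC. Qed.

(* A marked point [w1] that is not antipodal to [x] fixes the orientation of
   the cycle through [x], and every other marked point of the cycle follows. *)
Lemma orientation_determined c x d : (c = b \/ c = b^-1%g) -> x \in W ->
  (a ^+ d)%g x \in W -> (c ^+ d)%g x = (a ^+ d)%g x ->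
  (c ^+ d)%g ((a ^+ d)%g x) != x ->
  forall j, (a ^+ j)%g x \in W -> (a ^+ j)%g x = (c ^+ j)%g x.
Proof.
move=> cb Wx W1 cd; set w1 := (a ^+ d)%g x in W1 cd * => cw1 j Ww.
set w := (a ^+ j)%g x in Ww *; apply/eqP/negPn/negP => ne.
have cjw : (c ^+ j)%g w = x.
  apply/eqP; move: (pair_sign j cb Wx Ww).
  by rewrite eqxx [_ == w]eq_sym (negPf ne); case: (_ == x) => //; lia.
(* [K] stands for [j - d] modulo the orders of [a] and [c]. *)
pose K := j + d * (#[a]%g * #[c]%g).-1.
have dK : d + K = j + d * (#[a]%g * #[c]%g).
  have : 0 < #[a]%g * #[c]%g by rewrite muln_gt0 !order_gt0.
  by rewrite /K; case: (_ * _) => // n _; rewrite mulnS; lia.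
have aK : (a ^+ K)%g w1 = w.
  rewrite /w1 -permM -expgD dK expgD mulnCA expgM expg_order.
  by rewrite expg1n mulg1.
have cK u : (c ^+ K)%g ((c ^+ d)%g u) = (c ^+ j)%g u.
  by rewrite -permM -expgD dK expgD mulnA mulnC expgM expg_order expg1n mulg1.
(* The pair [w1], [w] at distance [K] forces [c ^+ K] to send [w] to [w1]; then [c ^+ d] sends [w1]
   to [x], against [cw1]. *)
move: (pair_sign K cb W1 Ww); rewrite aK eqxx -{2}cd cK [_ == w]eq_sym (negPf ne).
case: ((c ^+ K)%g w =P w1) => [cKw _|_]; last by lia.
move: cw1; rewrite -cKw -permM -expgD addnC expgD permM cK cjw.
by rewrite eqxx.
Qed.

(** If every marked point of the cycle is [x] or antipodal to [x], both orientations agree on them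
    and [b] serves. Otherwise a marked point that is neither selects the orientation. *)
Lemma orientation_exists x : x \in W -> exists2 c, c = b \/ c = b^-1%g &
  forall j, (a ^+ j)%g x \in W -> (a ^+ j)%g x = (c ^+ j)%g x.
Proof.
move=> Wx.
(* Exponents matter only modulo this common multiple of the orders, so a search below [n] is
   exhaustive. *)
pose n := #[a]%g * #[b]%g.
have n0 : 0 < n by rewrite muln_gt0 !order_gt0.
pose P := [exists d : 'I_n,
  ((a ^+ d)%g x \in W) && ((a ^+ d)%g ((a ^+ d)%g x) != x)].
have [/existsP [d /andP[Wd ad]]|/existsPn none] := boolP P; last first.
  exists b; first by left.
  move=> j.
  have an : (a ^+ n = 1)%g by rewrite expgM expg_order expg1n.
  have bn : (b ^+ n = 1)%g by rewrite /n mulnC expgM expg_order expg1n.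
  rewrite -(expg_mod j an) -(expg_mod j bn); set i := j %% n => Wi.
  move: (none (Ordinal (ltn_pmod j n0))); rewrite /= -/i Wi /= negbK => aa.
  move: (pairW i Wx Wi); rewrite eqxx aa [((b ^+ i)%g x) == _]eq_sym.
  by case: (_ =P (b ^+ i)%g x) => //; case: (_ == x); lia.
have cross : (b ^+ d)%g x = (a ^+ d)%g x /\ (b ^+ d)%g ((a ^+ d)%g x) != x \/
    (b^-1 ^+ d)%g x = (a ^+ d)%g x /\ (b^-1 ^+ d)%g ((a ^+ d)%g x) != x.
  have := pairW d Wx Wd; rewrite eqxx (negPf ad).
  have [bx|/eqP nbx] := (b ^+ d)%g x =P (a ^+ d)%g x => e.
    by left; split=> //; move: e; case: (_ == x) => //; lia.
  right; split; last by rewrite expgV_perm_eq.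
  by apply/eqP; rewrite expgV_perm_eq; move: e; case: (_ == x) => //; lia.
case: cross => [[bx bw]|[bx bw]].
  exists b; first by left.
  by apply: (orientation_determined (or_introl erefl) Wx Wd bx bw).
exists b^-1%g; first by right.
by apply: (orientation_determined (or_intror erefl) Wx Wd bx bw).
Qed.

(** Inside [S], [f] matches the fixed points of the two powers; subtracting them from [fixE] leaves
    equal numbers outside. *)
Lemma card_fix_compl S f k : partial_iso S f ->
  #|[set u in ~: S | (a ^+ k)%g u == u]| =
  #|[set v in ~: (f @: S) | (b ^+ k)%g v == v]|.
Proof.
move=> [Sa Sinj Sf _ _].
have split_fix (s : {perm T}) (A : {set T}) : #|[set u | (s ^+ k)%g u == u]| =
    #|[set u in A | (s ^+ k)%g u == u]| + #|[set u in ~: A | (s ^+ k)%g u == u]|.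
  rewrite -(cardsID A [set u | (s ^+ k)%g u == u]); congr (_ + _).
    by apply: eq_card => u; rewrite !inE andbC.
  by apply: eq_card => u; rewrite !inE.
have := fixE k; rewrite (split_fix a S) (split_fix b (f @: S)) => e.
apply/eqP; rewrite -(eqn_add2l #|[set u in S | (a ^+ k)%g u == u]|) e eqn_add2r.
apply/eqP; rewrite -[RHS](card_in_imset (f := f)); last first.
    by move=> u v; rewrite !inE => /andP[Su _] /andP[Sv _]; apply: Sinj.
suff fixf u : u \in S -> ((b ^+ k)%g (f u) == f u) = ((a ^+ k)%g u == u).
  apply: eq_card => v; rewrite !inE; apply/andP/imsetP.
    case=> /imsetP [u Su ->] bu; exists u => //.
    by rewrite !inE Su -fixf.
  case=> u; rewrite !inE => /andP[Su au] ->; rewrite fixf // au.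
  by split=> //; apply: imset_f.
move=> Su; have [c cb cf] := Sf u Su.
rewrite -[RHS](inj_in_eq Sinj) ?expg_closed // cf.
by case: cb => -> //; rewrite expgV_perm_eq.
Qed.

Lemma partial_iso_step S f : partial_iso S f -> S != setT ->
  exists (S' : {set T}) f', (S \proper S') /\ partial_iso S' f'.
Proof.
move=> Sf neST.
suff [x [y [c [Sx Sy cb per [Wx Wy]]]]] : exists x y c, [/\ x \notin S,
    {in S, forall u, f u != y}, c = b \/ c = b^-1%g,
    forall j, ((a ^+ j)%g x == x) = ((c ^+ j)%g y == y) &
    (forall j, (a ^+ j)%g x \in W -> (a ^+ j)%g x = (c ^+ j)%g y) /\
    (forall j, (c ^+ j)%g y \in W -> (c ^+ j)%g y \in porbit a x)].
  have [f' Sf'] := partial_iso_extend Sf Sx Sy cb per Wx Wy.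
  exists (S :|: porbit a x), f'; split=> //.
  apply/properP; split; first exact: subsetUl.
  by exists x => //; rewrite !inE porbit_id orbT.
have [Sa Sinj Sfc SW SfW] := Sf.
(* Cycles with a marked point come first: such a cycle goes to the [b]-cycle of the same point. *)
have [/subsetPn [x Wx Sx]|/negPn WS] := boolP (~~ (W \subset S)).
  have [c cb cW] := orientation_exists Wx.
  exists x, x, c; split=> //.
  (* The last clause of [partial_iso] ensures that a marked point outside [S] is not yet a value of
     [f]. *)
  - move=> u Su; apply: contraNN Sx => /eqP fu.
    by rewrite -fu; apply: SfW; rewrite ?fu.
  - move=> j; have := pair_sign j cb Wx Wx.
    by case: (_ == x); case: (_ == x).
  - split=> // j Wj; have := pair_sign j cb Wx Wj; rewrite eqxx.
    case: eqP => [<- _|_]; first exact: mem_porbit.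
    by case: eqP => [e _|_]; [rewrite porbit_sym -{1}e mem_porbit|lia].
(* With all marked points in [S], a shortest remaining cycle is matched. The least [k] with a
   remaining fixed point is the same for [a] and [b], and by minimality it is the exact length of
   both cycles. *)
pose Fx k := 0 < #|[set u in ~: S | (a ^+ k)%g u == u]|.
have xFx k x : x \notin S -> (a ^+ k)%g x = x -> Fx k.
  by move=> Sx ax; apply/card_gt0P; exists x; rewrite !inE Sx ax /=.
have [x0 Sx0] : exists x, x \notin S.
  by apply/existsP; rewrite -negb_forall; apply: contraNN neST => /forallP /= ST;
     apply/eqP/setP => x; rewrite inE ST.
have exk : exists k, (0 < k) && Fx k.
  by exists #[a]%g; rewrite order_gt0 (xFx _ x0) // expg_order perm1.
case: (ex_minnP exk) => k /andP[k0 Fk] kmin.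
have yFx j y : y \notin f @: S -> (b ^+ j)%g y = y -> Fx j.
  move=> Sy by_; rewrite /Fx (card_fix_compl _ Sf); apply/card_gt0P.
  by exists y; rewrite !inE Sy by_ /=.
have /card_gt0P [x] := Fk; rewrite !inE => /andP[Sx /eqP ax].
have := Fk; rewrite /Fx (card_fix_compl _ Sf) => /card_gt0P [y].
rewrite !inE => /andP[Sy /eqP by_].
have fSb u j : u \in S -> f u != (b ^+ j)%g y.
  move=> Su; have [c cb cf] := Sfc u Su; apply: contraNN Sy => /eqP fu.
  have [i ci] := expg_sign_inv j (or_introl erefl) cb.
  by apply/imsetP; exists ((a ^+ i)%g u); rewrite ?expg_closed // cf -ci fu permK.
exists x, y, b; split=> //; [|by left| |].
- by move=> u Su; have := fSb u 0 Su; rewrite expg0 perm1.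
- move=> j; rewrite (expg_fix_dvdn k0 ax) ?(expg_fix_dvdn k0 by_) // => i i0 e;
    apply: kmin; rewrite i0 /=; [exact: (yFx i y)|exact: (xFx i x)].
split=> j Wj.
  have := subsetP WS _ Wj => Sj; case/negP: Sx.
  by apply: porbit_closed Sj _; rewrite // porbit_sym mem_porbit.
have Sj := subsetP WS _ Wj.
by have := fSb _ j Sj; rewrite SW // eqxx.
Qed.

Lemma partial_iso_total : exists f, partial_iso setT f.
Proof.
suff ext n : forall S f, #|~: S| < n -> partial_iso S f ->
    exists f', partial_iso setT f'.
  by apply: (ext _ set0 id (ltnSn _)); split=> u; rewrite inE.
elim: n => // n IHn S f cardS Sf.
have [<-|neST] := eqVneq S setT; first by exists f.
have [S' [f' [ltSS' Sf']]] := partial_iso_step Sf neST.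
apply: (IHn S' f' _ Sf'); rewrite ltnS in cardS; apply: leq_trans cardS.
by apply: proper_card; rewrite properC.
Qed.

Lemma perm_graph_iso : exists f : {perm T}, {in W, forall w, f w = w} /\
  forall u v, (v == a u) + (u == a v) = (f v == b (f u)) + (f u == b (f v)).
Proof.
have [f [_ finj ff fW _]] := partial_iso_total.
have injf : injective f by move=> u v; apply: finj; rewrite inE.
exists (perm injf); split=> [w Ww|u v]; first by rewrite permE fW ?inE.
rewrite !permE; pose n := #[a]%g * #[b]%g.
have n0 : 0 < n by rewrite muln_gt0 !order_gt0.
(* The neighbours of [u] are its images under [a] and its inverse; the latter is written as a
   natural power, as [partial_iso] requires. *)
have an : (a ^+ n.-1 = a^-1)%g.
  apply: (mulIg a); rewrite -expgSr prednK // mulVg.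
  by rewrite expgM expg_order expg1n.
have bn : (b ^+ n.-1 = b^-1)%g.
  apply: (mulIg b); rewrite -expgSr prednK // mulVg.
  by rewrite /n mulnC expgM expg_order expg1n.
have [c cb cf] := ff u (in_setT u).
have := cf n.-1; have := cf 1; rewrite !expg1 an => c1 cV.
have -> : (u == a v) = (v == (a^-1)%g u) by apply/eqP/eqP => ->; rewrite ?permK ?permKV.
have symV w w' : (w == (b^-1)%g w') = (w' == b w).
  by apply/eqP/eqP => ->; rewrite ?permK ?permKV.
rewrite -(inj_eq injf) -(inj_eq injf v) c1 cV; case: cb => ->.
  by rewrite bn symV.
by rewrite addnC expgVn bn invgK symV.
Qed.

End PartialIsomorphism.

Lemma perm_extension (T : finType) (A : {set T}) (g : T -> T) :
  {in A &, injective g} -> exists s : {perm T}, {in A, s =1 g}.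
Proof.
move=> injg; pose rest := enum (~: (g @: A)).
(* The i-th point off [A] goes to the i-th point off the image of [A]; the two complements have
   equal size. *)
pose h x := if x \in A then g x else nth x rest (index x (enum (~: A))).
have sz : size rest = #|~: A|.
  rewrite -cardE; apply/eqP; rewrite -(eqn_add2l #|g @: A|) cardsC.
  by rewrite card_in_imset // cardsC.
have lt x : x \notin A -> index x (enum (~: A)) < size rest.
  by move=> xA; rewrite sz cardE index_mem mem_enum inE.
have hC x : x \notin A -> h x \notin g @: A.
  move=> xA; rewrite /h (negPf xA).
  by have := mem_nth x (lt x xA); rewrite mem_enum inE.
have injh : injective h.
  move=> x y; have [xA|xA] := boolP (x \in A); have [yA|yA] := boolP (y \in A).
  - by rewrite /h xA yA; apply: injg.
  - by move=> e; case/negP: (hC y yA); rewrite -e /h xA imset_f.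
  - by move=> e; case/negP: (hC x xA); rewrite e /h yA imset_f.
  - rewrite /h (negPf xA) (negPf yA) (set_nth_default x y) ?lt //.
    move/eqP; rewrite nth_uniq ?lt ?enum_uniq // => /eqP e.
    have mE z : z \notin A -> z \in enum (~: A) by rewrite mem_enum inE.
    by rewrite -(nth_index x (mE x xA)) e nth_index ?mE.
by exists (perm injh) => x xA; rewrite permE /h xA.
Qed.

(** * Sparsity around a small set of vertices *)

Lemma sum_setU (T : finType) (A B : {set T}) (F : T -> nat) : [disjoint A & B] ->
  \sum_(x in A :|: B) F x = \sum_(x in A) F x + \sum_(x in B) F x.
Proof.
by move=> dAB; rewrite -bigU //; apply: eq_bigl => x; rewrite !inE.
Qed.

(* More than [#|S|] vertices off [S] with a neighbour in [S] would, having two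
   such neighbours each, yield a set [X] that spans too many edges. So [sparse]
   applies to [U] itself, where all degrees are at least 2. *)
Lemma sparse_two_regular (T : finType) (e : rel T) (S : {set T}) :
  symmetric e -> (forall i, 2 <= \sum_j e i j) ->
  (forall X : {set T}, #|X| <= (2 * #|S|).+1 ->
     \sum_(i in X) \sum_(j in X) e i j <= 2 * #|X|) ->
  (forall w, w \notin S -> \sum_(j in S) e w j != 1) ->
  let U := S :|: [set w | 0 < \sum_(j in S) e w j] in
  forall u, u \in U -> \sum_(v in U) e u v = 2.
Proof.
move=> sym deg2 sparse dS U.
pose W := [set w | 0 < \sum_(j in S) e w j] :\: S.
have UE : U = S :|: W.
  by apply/setP => x; rewrite !inE; case: (x \in S).
have dW w : w \in W -> 2 <= \sum_(j in S) e w j.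
  by rewrite !inE => /andP[/dS]; case: (\sum_(_ in _) _) => [|[|]].
have leW : #|W| <= #|S|.
  rewrite leqNgt; apply/negP => /card_geqP [s [us ss sW]].
  pose V := [set x in s].
  have cV : #|V| = #|S|.+1 by rewrite cardsE (card_uniqP us).
  have dis : [disjoint S & V].
    rewrite disjoint_sym disjoints_subset; apply/subsetP => x.
    by rewrite !inE => /sW; rewrite !inE => /andP[].
  have cX : #|S :|: V| = (2 * #|S|).+1.
    by rewrite cardsU disjoint_setI0 // cards0 cV; lia.
  have := sparse (S :|: V); rewrite cX leqnn => /(_ isT).
  under eq_bigr => i _ do rewrite sum_setU //.
  rewrite big_split /= sum_setU // [X in _ + X]sum_setU //.
  rewrite [\sum_(i in S) \sum_(x in V) _]exchange_big /=.
  under [X in _ + (X + _)]eq_bigr => i _ do under eq_bigr => j _ do rewrite sym.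
  (* Edges between [S] and [V] count twice in the degree sum, so they alone give at least 4(|S|+1),
     more than the allowed 2(2|S|+1). *)
  suff : #|V| * 2 <= \sum_(i in V) \sum_(j in S) e i j by lia.
  rewrite -sum_nat_const; apply: leq_sum => w; rewrite inE => /sW Ww.
  exact: dW.
have disSW : [disjoint S & W].
  rewrite disjoint_sym disjoints_subset; apply/subsetP => x.
  by rewrite !inE => /andP[].
have deg2U u : u \in U -> 2 <= \sum_(v in U) e u v.
  rewrite {1}UE inE => /orP[uS|uW].
    (* All neighbours of a vertex of [S] lie in [U], so its whole degree is seen there. *)
    apply: leq_trans (deg2 u) _.
    rewrite (bigID (mem U)) /= [X in _ + X]big1 ?addn0 // => v.
    rewrite !inE negb_or => /andP[_].
    rewrite (bigD1 u) //= addn_gt0 negb_or => /andP[].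
    by rewrite sym; case: (e u v).
  by apply: leq_trans (dW u uW) _; rewrite UE sum_setU // leq_addr.
have cU : #|U| <= (2 * #|S|).+1.
  by rewrite UE (leq_trans (leq_card_setU _ _)) //; lia.
have [le2 eq2] := leqif_sum (fun u uU => leqif_eq (deg2U u uU)).
have : \sum_(u in U) 2 == \sum_(u in U) \sum_(v in U) e u v.
  by rewrite eqn_leq le2 sum_nat_const mulnC sparse.
by rewrite eq2 => /forall_inP h u /h /eqP.
Qed.

(** * Orthogonal conjugation of two-regular graphs *)

Local Open Scope ring_scope.

Section Conjugation.

Variables (R : realFieldType) (N : nat).
Implicit Types (Q X : 'M[R]_N) (s t : 'S_N).

Definition cycle_mx s k : 'M[R]_N := perm_mx (s ^+ k)%g + perm_mx (s ^+ k)^-1%g.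

Lemma cycle_mxE s k i j :
  cycle_mx s k i j = (((s ^+ k)%g i == j) + ((s ^+ k)%g j == i))%:R.
Proof.
rewrite !mxE natrD; congr (_%:R + _%:R).
by congr (nat_of_bool _); apply/eqP/eqP => [<-|<-]; rewrite ?permK ?permKV.
Qed.

Lemma cycle_mx_rec s k :
  cycle_mx s k.+2 = cycle_mx s 1 *m cycle_mx s k.+1 - cycle_mx s k.
Proof.
rewrite /cycle_mx expg1 mulmxDl !mulmxDr -!perm_mxM.
have -> : (s * (s ^+ k.+1)^-1 = (s ^+ k)^-1)%g by rewrite expgSr invMg mulKVg.
have -> : (s^-1 * s ^+ k.+1 = s ^+ k)%g by rewrite expgS mulKg.
have -> : (s^-1 * (s ^+ k.+1)^-1 = (s ^+ k.+2)^-1)%g by rewrite -invMg -expgSr.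
rewrite -expgS; apply/eqP; rewrite eq_sym subr_eq; apply/eqP.
by rewrite [X in _ + X = _]addrC addrACA [X in _ + X = _]addrC.
Qed.

(* [cycle_mx s k] is a Chebyshev polynomial of [cycle_mx s 1]. *)
Lemma conj_cycle_mx Q s t : Q *m Q^T = 1%:M -> Q^T *m Q = 1%:M ->
  Q^T *m cycle_mx s 1 *m Q = cycle_mx t 1 ->
  forall k, Q^T *m cycle_mx s k *m Q = cycle_mx t k.
Proof.
move=> QQt QtQ e1 k.
suff [] : Q^T *m cycle_mx s k *m Q = cycle_mx t k /\
  Q^T *m cycle_mx s k.+1 *m Q = cycle_mx t k.+1 by [].
elim: k => [|k [IH0 IH1]].
  split=> //; rewrite /cycle_mx !expg0 invg1 perm_mx1.
  by rewrite mulmxDr mulmxDl mulmx1 QtQ.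
split=> //; rewrite !cycle_mx_rec mulmxBr mulmxBl IH0 -e1 -IH1.
by rewrite !mulmxA -[_ *m Q *m Q^T]mulmxA QQt mulmx1.
Qed.

(** A permutation and its inverse have the same fixed points. Since conjugation preserves the trace,
    this yields the equality of fixed point counts. *)
Lemma mxtrace_cycle_mx s k :
  \tr (cycle_mx s k) = (2 * #|[set u | (s ^+ k)%g u == u]|)%:R.
Proof.
rewrite -sum1dep_card [in RHS]big_mkcond /= big_distrr /= natr_sum.
apply: eq_bigr => u _; rewrite cycle_mxE; congr (_%:R).
by case: (_ == u).
Qed.

Lemma conj_row_fixed Q X w j : (forall i, Q i w = (i == w)%:R) ->
  (Q^T *m X *m Q) w j = \sum_i X w i * Q i j.
Proof.
move=> Qw; rewrite mxE; apply: eq_bigr => i _; congr (_ * _).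
rewrite mxE (bigD1 w) //= mxE Qw eqxx mul1r big1 ?addr0 // => l /negPf lw.
by rewrite mxE Qw lw mul0r.
Qed.

Lemma conj_entry_fixed Q X w w' : (forall i, Q i w = (i == w)%:R) ->
  (forall i, Q i w' = (i == w')%:R) -> (Q^T *m X *m Q) w w' = X w w'.
Proof.
move=> Qw Qw'; rewrite conj_row_fixed // (bigD1 w') //= Qw' eqxx mulr1.
by rewrite big1 ?addr0 // => i /negPf iw'; rewrite Qw' iw' mulr0.
Qed.

Lemma mulmx_tr_eq0 m (z : 'M[R]_(m, 1)) : z^T *m z = 0 -> z = 0.
Proof.
move=> /matrixP/(_ 0 0); rewrite !mxE => /eqP.
rewrite psumr_eq0 => [/allP z0|i _]; last by rewrite mxE -expr2 sqr_ge0.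
apply/matrixP => i j; rewrite ord1 [RHS]mxE; apply/eqP.
by have := z0 i (mem_index_enum i); rewrite mxE mulf_eq0 orbb.
Qed.

(* [2 - cycle_mx s 1] is the Gram matrix of [perm_mx s - 1], so a vector whose
   quadratic form reaches the bound 2 is fixed by [perm_mx s]. *)
Lemma cycle_mx_eigen s (y : 'cV[R]_N) :
  y^T *m cycle_mx s 1 *m y = 2 *: (y^T *m y) -> cycle_mx s 1 *m y = 2 *: y.
Proof.
pose P : 'M[R]_N := perm_mx s; have PE : cycle_mx s 1 = P + P^T.
  by rewrite /cycle_mx expg1 tr_perm_mx.
have PtP : P^T *m P = 1%:M by rewrite tr_perm_mx -perm_mxM mulVg perm_mx1.
rewrite PE => e; have : P *m y - y = 0.
  apply: mulmx_tr_eq0.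
  rewrite [(_ - _)^T]linearB /= trmx_mul mulmxBl !mulmxBr -!mulmxA.
  rewrite (mulmxA P^T P) PtP mul1mx.
  move: e; rewrite mulmxDr mulmxDl -!mulmxA scaler_nat mulr2n => e.
  by apply/eqP; rewrite subr_eq0 subr_eq addrAC e addrK.
move/subr0_eq => Py; rewrite mulmxDl Py scaler_nat mulr2n; congr (_ + _).
by rewrite -[in LHS]Py mulmxA PtP mul1mx.
Qed.

End Conjugation.

(** * Graphs conjugate under a matrix that is the identity off a small set *)

Section ConjugateGraphs.

Variables (R : realFieldType) (N : nat) (Q : 'M[R]_N) (I : {set 'I_N}).
Variables (a b : rel 'I_N).
Let A : 'M[R]_N := \matrix_(i, j) (a i j)%:R.
Let B : 'M[R]_N := \matrix_(i, j) (b i j)%:R.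

Hypotheses (syma : symmetric a) (symb : symmetric b).
Hypotheses (irra : irreflexive a) (irrb : irreflexive b).
Hypotheses (QtQ : Q^T *m Q = 1%:M) (QAQ : Q^T *m A *m Q = B).
Hypothesis Qid : forall i j, (i \notin I) || (j \notin I) -> Q i j = (i == j)%:R.
Hypothesis rowI : forall i j, i \in I -> exists l, Q i l != (l == j)%:R.

Let QQt : Q *m Q^T = 1%:M. Proof. exact: mulmx1C. Qed.

Lemma conj_row_off w j : w \notin I -> (b w j)%:R = \sum_i (a w i)%:R * Q i j.
Proof.
move=> wI; have /matrixP/(_ w j) := QAQ; rewrite [RHS]mxE => <-.
rewrite conj_row_fixed => [|i]; last by rewrite Qid // wI orbT.
by apply: eq_bigr => i _; rewrite mxE.
Qed.

(* A vertex off [I] with a single neighbour [i] in [I] would make the [i]-th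
   row of [Q] a 0/1 vector of norm one, that is a standard basis vector. *)
Lemma degree_off_neq1 w : w \notin I -> (\sum_(j in I) a w j)%N != 1%N.
Proof.
move=> wI; apply/negP => /sum_nat_eq1 [i [iI /eqP awi1 a0]].
have awi : a w i by case: (a w i) awi1.
have Qij j : j \in I -> Q i j = (b w j)%:R.
  move=> jI; rewrite conj_row_off // (bigD1 i) //= awi mul1r big1 ?addr0 // => l li.
  have [lI|lI] := boolP (l \in I); first by rewrite a0 ?mul0r.
  rewrite Qid ?lI // (_ : l == j = false) ?mulr0 //.
  by apply/eqP => lj; rewrite lj jI in lI.
pose g j := (j \in I) && b w j.
have Qg j : Q i j = (g j)%:R.
  have [jI|jI] := boolP (j \in I); first by rewrite Qij // /g jI.
  rewrite Qid ?jI ?orbT // /g (negPf jI) (_ : i == j = false) //.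
  by apply/eqP => ij; rewrite -ij iI in jI.
have : (\sum_j g j)%N == 1%N.
  rewrite -(eqr_nat R) natr_sum; apply/eqP.
  have /matrixP/(_ i i) := QQt; rewrite !mxE eqxx => <-.
  by apply: eq_bigr => j _; rewrite mxE Qg -natrM mulnb andbb.
move=> /sum_nat_eq1 [j [_ gj g0]].
have [l] := rowI j iI; rewrite Qg.
have [->|lj] := eqVneq l j; first by rewrite gj eqxx.
by rewrite g0 // eqxx.
Qed.

Hypothesis deg2 : forall i, (2 <= \sum_j a i j)%N.
Hypothesis sparse : forall X : {set 'I_N}, (#|X| <= (2 * #|I|).+1)%N ->
  (\sum_(i in X) \sum_(j in X) a i j <= 2 * #|X|)%N.

Let U := I :|: [set w | (0 < \sum_(j in I) a w j)%N].

(* Off [U], double loops make every vertex of the graph have degree 2. *)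
Definition loop_closure (e : rel 'I_N) u v : nat :=
  if (u \in U) && (v \in U) then nat_of_bool (e u v) else (2 * (u == v))%N.

Lemma loop_closure_sym e : symmetric e ->
  forall u v, loop_closure e u v = loop_closure e v u.
Proof. by move=> syme u v; rewrite /loop_closure andbC syme eq_sym. Qed.

Lemma loop_closure_diag e : irreflexive e -> forall u, loop_closure e u u != 1%N.
Proof.
by move=> irre u; rewrite /loop_closure irre eqxx; case: (_ && _).
Qed.

Definition loop_closure_mx e : 'M[R]_N := \matrix_(u, v) (loop_closure e u v)%:R.

(** With [P] the coordinate projection onto [U], the closure is P A P + 2(1 - P), and [Q] commutes
    with [P] because it is the identity off a subset of [U]. *)
Lemma conj_loop_closure :
  Q^T *m loop_closure_mx a *m Q = loop_closure_mx b.
Proof.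
pose P : 'M[R]_N := diag_mx (\row_i (i \in U)%:R).
have decomp e : loop_closure_mx e =
    P *m (\matrix_(i, j) (e i j)%:R) *m P + 2 *: (1%:M - P).
  apply/matrixP => u v; rewrite mul_diag_mx mul_mx_diag !mxE /loop_closure.
  case: (eqVneq u v) => [->|_]; case: (v \in U); try case: (u \in U);
    by rewrite /= ?muln1 ?muln0 ?mulr1n ?mulr0n; ring.
have IU i : i \notin U -> i \notin I by rewrite inE negb_or => /andP[].
have PQ : P *m Q = Q *m P.
  apply/matrixP => i j; rewrite mul_diag_mx mul_mx_diag !mxE.
  have [iU|iU] := boolP (i \in U); have [jU|jU] := boolP (j \in U);
    rewrite ?mul0r ?mulr0 ?mul1r ?mulr1 //.
    rewrite Qid; last by rewrite (IU j) ?orbT.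
    by case: eqVneq => // ij; rewrite -ij iU in jU.
  rewrite Qid; last by rewrite (IU i).
  by case: eqVneq => // ij; rewrite ij jU in iU.
have PQt : Q^T *m P = P *m Q^T.
  by have /(congr1 trmx) := PQ; rewrite !trmx_mul tr_diag_mx.
rewrite !decomp mulmxDr mulmxDl -/A -/B -QAQ !mulmxA PQt.
rewrite -!mulmxA PQ; congr (_ + _).
rewrite -scalemxAl -scalemxAr mulmxBl mulmxBr mul1mx PQ mulmxA QtQ.
by rewrite mul1mx.
Qed.

Lemma loop_closure_regular u : (\sum_v loop_closure a u v)%N = 2%N.
Proof.
have [uU|uU] := boolP (u \in U).
  rewrite -(sparse_two_regular syma deg2 sparse degree_off_neq1 uU).
  rewrite [RHS]big_mkcond /=; apply: eq_bigr => v _.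
  rewrite /loop_closure uU /=; case: ifP => // vU.
  by case: eqVneq => // uv; rewrite uv vU in uU.
rewrite (bigD1 u) //= /loop_closure (negPf uU) eqxx big1 // => v /negPf vu.
by rewrite eq_sym vu.
Qed.

(** Entries are 0 or 1 except for the diagonal 2s off [U], each of which exceeds its value by 2 when
    squared. So the sum of the entries is expressed by the Frobenius norm, which orthogonal
    conjugation preserves. *)
Lemma loop_closure_sum e : \sum_u \sum_v (loop_closure e u v)%:R =
  \tr (loop_closure_mx e *m (loop_closure_mx e)^T) - (2 * #|~: U|)%:R :> R.
Proof.
apply/eqP; rewrite eq_sym subr_eq; apply/eqP.
have sq u v : (loop_closure e u v * loop_closure e u v =
    loop_closure e u v + 2 * ((u \notin U) * (v == u)))%N.
  rewrite /loop_closure eq_sym; have [uU|uU] := boolP (u \in U); last first.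
    by case: eqP.
  have [vU|vU] := boolP (v \in U); first by case: (e u v).
  by case: eqVneq => // vu; rewrite vu uU in vU.
rewrite -sum1_card big_distrr /= natr_sum [X in _ = _ + X]big_mkcond -big_split /=.
apply: eq_bigr => u _; rewrite !mxE.
under [LHS]eq_bigr => v _ do rewrite !mxE -natrM sq natrD.
rewrite big_split /= -[X in _ + X = _]natr_sum -!big_distrr /= sum_pred1 muln1.
by rewrite [u \in ~: U]inE; case: (u \in U); rewrite ?addr0.
Qed.

(** The entry sums agree, so the all-ones vector reaches the bound 2 for the quadratic form of [b].
    Its image [y] under [Q] does so for [a], hence is an eigenvector by [cycle_mx_eigen], and
    transporting back gives row sums 2. *)
Lemma loop_closure_conj_regular u : (\sum_v loop_closure b u v)%N = 2%N.
Proof.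
have [s sP] := two_regular_perm (loop_closure_sym syma) loop_closure_regular
  (loop_closure_diag irra).
have sE : loop_closure_mx a = cycle_mx R s 1.
  by apply/matrixP => i j; rewrite cycle_mxE mxE sP expg1 ![_ i == j]eq_sym [_ j == i]eq_sym.
pose one : 'cV[R]_N := const_mx 1.
pose y := Q *m one.
have quad e : one^T *m loop_closure_mx e *m one =
    (\sum_i \sum_j (loop_closure e i j)%:R)%:M.
  apply/matrixP => i j; rewrite !ord1 !mxE exchange_big /=.
  apply: eq_bigr => k _; rewrite !mxE mulr1.
  by apply: eq_bigr => l _; rewrite !mxE mul1r.
have qa : one^T *m loop_closure_mx a *m one = 2 *: (one^T *m one).
  rewrite quad; apply/matrixP => i j; rewrite !ord1 !mxE eqxx mulr1n big_distrr /=.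
  by apply: eq_bigr => k _; rewrite !mxE mul1r mulr1 -natr_sum loop_closure_regular.
have qb : one^T *m loop_closure_mx b *m one = 2 *: (one^T *m one).
  rewrite -qa !quad !loop_closure_sum -conj_loop_closure; congr (_ - _)%:M.
  rewrite !trmx_mul trmxK !mulmxA -[_ *m Q *m Q^T]mulmxA QQt mulmx1.
  by rewrite mxtrace_mulC !mulmxA QQt mul1mx.
have : loop_closure_mx b *m one = 2 *: one.
  rewrite -conj_loop_closure -!mulmxA -/y sE cycle_mx_eigen.
    by rewrite -scalemxAr mulmxA QtQ mul1mx.
  rewrite -sE /y trmx_mul -[X in 2 *: X]mulmxA (mulmxA Q^T) QtQ mul1mx.
  by rewrite -qb -conj_loop_closure !mulmxA.
move=> /matrixP/(_ u 0); rewrite !mxE mulr1 => e.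
apply/eqP; rewrite -(eqr_nat R) natr_sum -e; apply/eqP.
by apply: eq_bigr => v _; rewrite !mxE mulr1.
Qed.

Lemma conjugate_graph_iso : exists f : 'S_N, forall u v, a u v = b (f u) (f v).
Proof.
have [s sP] := two_regular_perm (loop_closure_sym syma) loop_closure_regular
  (loop_closure_diag irra).
have [t tP] := two_regular_perm (loop_closure_sym symb) loop_closure_conj_regular
  (loop_closure_diag irrb).
have mxE1 e (p : 'S_N) : (forall u v, loop_closure e u v = (v == p u) + (u == p v))%N ->
    loop_closure_mx e = cycle_mx R p 1.
  move=> eP; apply/matrixP => i j; rewrite cycle_mxE mxE eP expg1.
  by rewrite ![_ i == j]eq_sym [_ j == i]eq_sym.
have conj k : Q^T *m cycle_mx R s k *m Q = cycle_mx R t k.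
  by apply: conj_cycle_mx => //; rewrite -(mxE1 _ _ sP) conj_loop_closure (mxE1 _ _ tP).
have Qcol w i : w \in ~: I -> Q i w = (i == w)%:R.
  by rewrite inE => wI; rewrite Qid ?wI ?orbT.
have pairW k : {in ~: I &, forall w w',
    ((s ^+ k)%g w == w') + ((s ^+ k)%g w' == w) =
    ((t ^+ k)%g w == w') + ((t ^+ k)%g w' == w)}%N.
  move=> w w' wI w'I; apply/eqP; rewrite -(eqr_nat R) -!cycle_mxE -conj.
  by rewrite conj_entry_fixed // => i; rewrite Qcol.
have fixE k : #|[set u | (s ^+ k)%g u == u]| = #|[set u | (t ^+ k)%g u == u]|.
  apply/eqP; rewrite -(eqn_pmul2l (isT : (0 < 2)%N)) -(eqr_nat R).
  by rewrite -!mxtrace_cycle_mx -conj mxtrace_mulC mulmxA QQt mul1mx.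
have [f [fW fE]] := perm_graph_iso pairW fixE.
have fI u : u \in I -> f u \in I.
  move=> uI; apply/negPn/negP => fuI.
  have := fW (f u); rewrite inE fuI => /(_ isT) /perm_inj e.
  by rewrite e uI in fuI.
have natb (x y : bool) : (x%:R = y%:R :> R) -> x = y.
  by move/eqP; rewrite eqr_nat; case: x; case: y.
have fU u : u \in U -> f u \in U.
  have [uI _|uI] := boolP (u \in I); first by rewrite !inE fI.
  by rewrite fW // inE.
have loopE u v : loop_closure a u v = loop_closure b (f u) (f v).
  by rewrite sP tP fE.
(* Such a [u] is fixed by [f] and has no neighbour in [I], so only trivial rows of [Q] enter
   [conj_row_off]: [u] keeps its neighbours off [I] and gains none in [I]. *)
have offU u v : u \notin U -> a u v = b (f u) (f v).
  rewrite !inE negb_or => /andP[uI du]; rewrite [f u]fW ?inE //.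
  have au i : i \in I -> a u i = false.
    by move=> iI; move: du; rewrite (bigD1 i) //=; case: (a u i).
  have [vI|vI] := boolP (v \in I); last first.
    rewrite [f v]fW ?inE //; apply: natb.
    rewrite conj_row_off // (bigD1 v) //=.
    rewrite Qid ?vI ?orbT // eqxx mulr1 big1 ?addr0 // => i /negPf iv.
    by rewrite Qid ?vI ?orbT // iv mulr0.
  rewrite au //; apply/esym/natb; rewrite conj_row_off //.
  rewrite big1 // => i _; have [iI|iI] := boolP (i \in I); first by rewrite au ?mul0r.
  rewrite Qid ?iI // (_ : i == f v = false) ?mulr0 //.
  by apply/eqP => e; rewrite e fI in iI.
exists f => u v; have [uU|/offU //] := boolP (u \in U).
have [vU|vU] := boolP (v \in U); last by rewrite syma symb offU.
have := loopE u v; rewrite /loop_closure uU vU !fU //=.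
by case: (a u v); case: (b _ _).
Qed.

End ConjugateGraphs.

(** * Switchings of locally sparse graphs *)

From mathcomp Require Import all_classical all_reals all_analysis.
Import numFieldNormedType.Exports.

(** Permuting columns by [t] moves the entry 1 of each standard basis row of [Q0] to the diagonal.
    The result [Qh] is the identity off at most [m] indices, so [conjugate_graph_iso] applies to
    [b], the switched graph relabelled by [t]. *)
Lemma switching_iso (R : realType) (m k : nat) (a : rel 'I_(m + k)) (Q : 'M[R]_m) :
  symmetric a -> irreflexive a -> (forall i, 2 <= \sum_j a i j)%N ->
  (forall X : {set 'I_(m + k)}, #|X| <= (2 * m).+1 ->
     \sum_(i in X) \sum_(j in X) a i j <= 2 * #|X|)%N ->
  real_orthogonal Q -> simple_adjmx (switch_mx Q (adjmx R a id)) ->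
  iso_adjmx (adjmx R a id) (switch_mx Q (adjmx R a id)).
Proof.
move=> syma irra deg2 sparse orthQ; set M := switch_mx _ _ => simpleM.
pose Q0 : 'M[R]_(m + k) := block_mx Q 0 0 1%:M.
have Q0tQ0 : Q0^T *m Q0 = 1%:M.
  rewrite /Q0 tr_block_mx mulmx_block !trmx0 !mul0mx !mulmx0 trmx1 mulmx1.
  by rewrite orthQ !addr0 add0r -scalar_mx_block.
have Q0Q0t := mulmx1C Q0tQ0.
pose b0 i j := M i j == 1.
have ME i j : M i j = (b0 i j)%:R.
  rewrite /b0; have [[->|->] _] := simpleM i j; first by rewrite eq_sym oner_eq0.
  by rewrite eqxx.
pose std i j := [forall l, Q0 i l == (l == j)%:R].
pose S := [set i | [exists j, std i j]].
pose g i := odflt i [pick j | std i j].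
have gP i l : i \in S -> Q0 i l = (l == g i)%:R.
  rewrite inE /g; case: pickP => [j /forallP Qj _|no /existsP [j]]; last by rewrite no.
  exact/eqP.
have injg : {in S &, injective g}.
  move=> i i' iS i'S e; have /matrixP/(_ i i') := Q0Q0t.
  rewrite mxE [RHS]mxE (bigD1 (g i)) //= [Q0^T _ _]mxE !gP // -e eqxx mulr1 big1 ?addr0 => [|l /negPf lg].
    by case: eqVneq => // _ /eqP; rewrite oner_eq0.
  by rewrite gP // lg mul0r.
have [t tg] := perm_extension injg.
pose Qh : 'M[R]_(m + k) := \matrix_(i, j) Q0 i (t j).
pose b i j := b0 (t i) (t j).
have QhX X : Qh^T *m X *m Qh = \matrix_(i, j) (Q0^T *m X *m Q0) (t i) (t j).
  apply/matrixP => i j; rewrite !mxE; apply: eq_bigr => l _; rewrite !mxE.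
  by congr (_ * _); apply: eq_bigr => l' _; rewrite !mxE.
have QhQh : Qh^T *m Qh = 1%:M.
  rewrite -[Qh^T]mulmx1 QhX mulmx1 Q0tQ0; apply/matrixP => i j.
  by rewrite !mxE (inj_eq perm_inj).
have rowS i j : i \in S -> Qh i j = (i == j)%:R.
  by move=> iS; rewrite mxE gP // -tg // (inj_eq perm_inj) eq_sym.
(* Row [j] is a standard basis vector and the other rows are orthogonal to it, so they vanish in
   column [j]. *)
have colS i j : j \in S -> Qh i j = (i == j)%:R.
  move=> jS; have [->|ij] := eqVneq i j; first by rewrite rowS // eqxx.
  have /matrixP/(_ j i) := mulmx1C QhQh; rewrite mxE [X in _ = X -> _]mxE [j == i]eq_sym (negPf ij).
  rewrite (bigD1 j) //= [X in _ + X]big1 => [|l /negPf lj].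
    by rewrite addr0 rowS // eqxx mul1r [Qh^T _ _]mxE.
  by rewrite rowS // eq_sym lj mul0r.
(* The last [k] rows of [Q0], from the identity block, are standard basis vectors. *)
have cardS : (#|~: S| <= m)%N.
  rewrite -[m in (_ <= m)%N]card_ord -(card_imset _ (@lshift_inj m k)).
  apply: subset_leq_card; apply/fintype.subsetP => i; rewrite inE.
  case: (splitP i) => [j ij _|j ij].
    by rewrite (_ : i = lshift k j) ?imset_f //; apply: val_inj.
  rewrite inE => /existsPn /(_ (rshift m j)) /forallPn [l].
  have -> : i = rshift m j by apply: val_inj.
  case: (split_ordP l) => l' ->.
    by rewrite block_mxEdl mxE eq_lrshift eqxx.
  by rewrite block_mxEdr mxE eq_rshift [l' == j]eq_sym eqxx.
have [||||||||||f fE] := @conjugate_graph_iso R _ Qh (~: S) a b.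
- exact: syma.
- by move=> i j; rewrite /b /b0; have [_ [-> _]] := simpleM (t i) (t j).
- exact: irra.
- move=> i; rewrite /b /b0; have [_ [_ ->//]] := simpleM (t i) (t i).
  by rewrite eq_sym oner_eq0.
- exact: QhQh.
- rewrite QhX; apply/matrixP => i j; rewrite mxE [RHS]mxE; exact: ME.
- by move=> i j; rewrite !finset.in_setC !negbK => /orP[iS|jS]; [exact: rowS|exact: colS].
- move=> i j; rewrite finset.in_setC => iS; apply/existsP; apply: contraNT iS.
  rewrite negb_exists => /forallP e; rewrite inE; apply/existsP; exists (t j).
  apply/forallP => l; move: (e (t^-1 l)%g); rewrite negbK [Qh _ _]mxE permKV.
  suff -> : ((t^-1)%g l == j) = (l == t j) by [].
  by rewrite -(inj_eq (@perm_inj _ t)) permKV.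
- exact: deg2.
- move=> X cX; apply: sparse; apply: leq_trans cX _.
  by rewrite ltnS leq_mul2l cardS orbT.
(* [f] followed by [t] leads from the original to the switched graph, whereas [iso_adjmx] asks for
   the opposite direction. *)
exists (f * t)^-1%g => i j.
have ftK x : t (f ((f * t)^-1%g x)) = x by rewrite -(permM f t) permKV.
by rewrite ME [RHS]mxE fE /b !ftK.
Qed.

(** After [j] rounds the set is stable or has lost at least [j] vertices; at [j = #|S|] the second
    case leaves the empty set. Stability is what gives minimum degree 2. *)
Lemma core2_stable n (D : {set 'I_n * 'I_n}) (S : {set 'I_n}) :
  core_step D (core2 D S) = core2 D S.
Proof.
have sub X : core_step D X \subset X by apply/fintype.subsetP => v; rewrite inE => /andP[].
suff stab j : core_step D (iter j (core_step D) S) = iter j (core_step D) S \/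
    (#|iter j (core_step D) S| + j <= #|S|)%N.
  have [//|] := stab #|S|; rewrite -[X in (_ <= X)%N]add0n leq_add2r leqn0 cards_eq0.
  rewrite -/(core2 D S) => /eqP ->; apply/eqP; rewrite -finset.subset0; exact: sub.
elim: j => [|j [IH|IH]] /=; first by right; rewrite addn0.
  by left; rewrite !IH.
have [e|ne] := eqVneq (core_step D (iter j (core_step D) S)) (iter j (core_step D) S).
  by left; rewrite !e.
right; rewrite addnS -addSn; apply: leq_trans IH; rewrite leq_add2r.
by apply: proper_card; rewrite finset.properEneq ne sub.
Qed.

(** The bound 2m+1 is the largest size of a set of at most [m] switched vertices together with one
    more outside vertex than its size. *)
Definition locally_sparse m n (D : {set 'I_n * 'I_n}) : bool :=
  [forall X : {set 'I_n}, (#|X| <= (2 * m).+1)%N ==> (#|D :&: finset.setX X X| <= #|X|)%N].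

Lemma locally_sparse_no_bad_event (R : realType) m n (D : {set 'I_n * 'I_n}) :
  simple_edges D -> locally_sparse m D -> ~ bad_event R m n D.
Proof.
move=> /forall_inP simpleD /forallP sparseD [C [_ [k [s [[injs sK cardK] [Q [orthQ _ simpleM noiso]]]]]]].
apply: noiso; set K := core2 D C in sK cardK.
pose a : rel 'I_(m + k) := fun i j => adj D (s i) (s j).
have syma : symmetric a by move=> i j; rewrite /a /adj orbC.
have imS : [set s i | i in 'I_(m + k)]%SET = K.
  apply/eqP; rewrite eqEcard card_imset // card_ord cardK leqnn andbT.
  by apply/fintype.subsetP => x /imsetP [i _ ->].
have := @switching_iso R m k a Q syma; apply=> //.
- move=> i; apply/negP; rewrite /a /adj orbb => /simpleD.
  by rewrite ltnn.
- move=> i; have := sK i; rewrite /K -core2_stable finset.inE -/K => /andP[_ lt1].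
  suff -> : (\sum_j a i j)%N = #|[set u in K | adj D (s i) u]| by [].
  rewrite -imS (_ : [set u in _ | _] = s @: [set j | a i j]%SET).
    by rewrite card_imset // -sum1dep_card [RHS]big_mkcond; apply: eq_bigr => j _; case: (a i j).
  apply/setP => u; rewrite !inE; apply/andP/imsetP => [[/imsetP [j _ ->] aij]|].
    by exists j; rewrite ?inE.
  by case=> j; rewrite inE => aij ->; split=> //; apply: imset_f.
- move=> X cX; have := sparseD (s @: X); rewrite card_imset // cX /=.
  set E := _ :&: _ => le; apply: leq_trans (leq_mul (leqnn 2) le).
  have cE : #|E| = (\sum_(i in X) \sum_(j in X) ((s i, s j) \in D))%N.
    pose F := [set p | (p.1 \in X) && (p.2 \in X) && ((s p.1, s p.2) \in D)]%SET.
    have -> : E = [set (s p.1, s p.2) | p in F]%SET.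
      apply/setP => -[x y]; rewrite !finset.inE; apply/idP/imsetP.
        case/and3P=> Dxy /imsetP [i iX xi] /imsetP [j jX yj].
        by exists (i, j); rewrite ?finset.inE /= ?iX ?jX -?xi -?yj.
      case=> -[i j]; rewrite finset.inE /= => /andP[/andP[iX jX] Dij] [-> ->].
      by rewrite Dij !imset_f.
    rewrite card_imset => [|[i j] [i' j'] /= [/injs -> /injs ->] //].
    rewrite pair_big -sum1_card big_mkcond [RHS]big_mkcond /=.
    by apply: eq_bigr => -[i j] _; rewrite finset.inE /=; case: (i \in X); case: (j \in X); case: (_ \in D).
  (* [D] lists each edge in one order only; this second count covers the reversed pairs, and the two
     together bound the degree sum. *)
  have cE' : #|E| = (\sum_(i in X) \sum_(j in X) ((s j, s i) \in D))%N.
    by rewrite cE exchange_big.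
  rewrite mul2n -addnn {1}cE cE' -big_split /=; apply: leq_sum => i iX.
  rewrite -big_split /=; apply: leq_sum => j jX; rewrite /a /adj.
  by case: (_ \in D); case: (_ \in D).
Qed.

(** * The first moment bound *)

Lemma sum_exprn_card (R : comPzRingType) (T : finType) (x : R) :
  \sum_(J : {set T}) x ^+ #|J| = (1 + x) ^+ #|T|.
Proof.
rewrite addrC -prodr_const bigA_distr /=.
apply: eq_bigr => J _; rewrite -big_mkcond /= prodr_const.
by [].
Qed.

Lemma sum_supersets (R : comPzRingType) (T : finType) (E F : {set T}) (p : R) :
  F \subset E ->
  \sum_(J : {set T} | (J \subset E) && (F \subset J))
     p ^+ #|J| * (1 - p) ^+ (#|E| - #|J|) = p ^+ #|F|.
Proof.
move=> FE.
(* In the expanded product, the zeros of [f] force [J] into [E] and those of [g] force [F] into [J];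
   an index of [E] outside [F] contributes p + (1 - p) = 1. *)
pose f i : R := if i \in E then p else 0.
pose g i : R := if i \in F then 0 else if i \in E then 1 - p else 1.
transitivity (\prod_i (f i + g i)); last first.
  rewrite -prodr_const [RHS]big_mkcond /=; apply: eq_bigr => i _; rewrite /f /g.
  have [iF|iF] := boolP (i \in F); first by rewrite (fintype.subsetP FE) // addr0.
  by case: (i \in E); rewrite ?add0r // addrC subrK.
rewrite bigA_distr big_mkcond /=; apply: eq_bigr => J _.
have [/andP[JE FJ]|nJ] := ifPn.
  rewrite -cardsDS // -!prodr_const big_mkcond [X in _ * X]big_mkcond -big_split /=.
  apply: eq_bigr => i _; rewrite inE /f /g.
  have [iJ|iJ] := boolP (i \in J); first by rewrite (fintype.subsetP JE) // mulr1.
  rewrite mul1r /= (negPf (contra (fintype.subsetP FJ i) iJ)).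
  by [].
move: nJ; rewrite negb_and => /orP[/subsetPn [i iJ iE]|/subsetPn [i iF iJ]].
  by rewrite (bigD1 i) //= iJ /f (negPf iE) mul0r.
by rewrite (bigD1 i) //= (negPf iJ) /g iF mul0r.
Qed.

Definition all_edges n : {set 'I_n * 'I_n} := [set d : 'I_n * 'I_n | (d.1 < d.2)%N]%SET.

Lemma card_all_edges n : #|all_edges n| = 'C(n, 2).
Proof.
rewrite -bin2_sum big_mkord -sum1_card.
rewrite (eq_bigl (fun d : 'I_n * 'I_n => true && (d.1 < d.2)%N)); last by move=> d; rewrite inE.
rewrite -(pair_big_dep xpredT (fun i j : 'I_n => (i < j)%N) (fun _ _ => 1%N)) /=.
rewrite (exchange_big_dep xpredT) //=; apply: eq_bigr => j _.
by rewrite -(big_ord_widen n (fun=> 1%N) (ltnW (ltn_ord j))) sum1_card card_ord.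
Qed.

Lemma simple_edgesE n (D : {set 'I_n * 'I_n}) :
  simple_edges D = (D \subset all_edges n).
Proof.
apply/forall_inP/fintype.subsetP => [h d /h|h d /h]; by rewrite inE.
Qed.

Lemma prob_subgraph (R : realType) n (F : {set 'I_n * 'I_n}) (p : R) : F \subset all_edges n ->
  Gnp_prob n p (fun D => F \subset D) = p ^+ #|F|.
Proof.
move=> FE; rewrite -(sum_supersets p FE) /Gnp_prob card_all_edges.
by apply: eq_bigl => D; rewrite simple_edgesE asboolb.
Qed.

Lemma not_locally_sparse m n (D : {set 'I_n * 'I_n}) : simple_edges D -> ~~ locally_sparse m D ->
  exists X : {set 'I_n}, exists F : {set 'I_n * 'I_n},
  [/\ (#|X| <= (2 * m).+1)%N, F \subset finset.setX X X :&: all_edges n, #|F| = #|X|.+1 &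
   F \subset D].
Proof.
rewrite simple_edgesE => /fintype.subsetP sD /forallPn [X]; rewrite negb_imply -ltnNge => /andP[cX].
case/card_geqP=> s [us ss /= sDX].
exists X, [set x in s]%SET; split=> //.
- apply/fintype.subsetP => x; rewrite inE => /sDX; rewrite finset.in_setI => /andP[xD xX].
  by rewrite finset.in_setI xX sD.
- by rewrite cardsE (card_uniqP us).
- by apply/fintype.subsetP => x; rewrite inE => /sDX; rewrite finset.in_setI => /andP[].
Qed.

(** Union bound over vertex sets [X] and sets [F] of exactly |X|+1 edges inside [X]. The power of 2
    bounds the number of [F] for one [X], and each [F] is present with probability p^(|X|+1). *)
Lemma prob_bad_event_le (R : realType) m n (lam : R) : 1 <= lam -> lam <= n%:R ->
  Gnp_prob n (lam / n%:R) (bad_event R m n) <=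
  (2 ^ ((2 * m).+1 ^ 2))%:R * expR 1 * (lam ^+ (2 * m + 2) / n%:R).
Proof.
move=> lam1 lamn; set p := lam / n%:R; set c := (2 ^ _)%N.
have n0 : 0 < n%:R :> R by apply: lt_le_trans lamn; apply: lt_le_trans lam1.
have l0 : 0 <= lam by apply: le_trans lam1.
have p0 : 0 <= p by rewrite divr_ge0 // ltW.
have p1 : 0 <= 1 - p by rewrite subr_ge0 ler_pdivrMr // mul1r.
pose FX (X : {set 'I_n}) (F : {set 'I_n * 'I_n}) :=
  (F \subset finset.setX X X :&: all_edges n) && (#|F| == #|X|.+1).
pose small (X : {set 'I_n}) := (#|X| <= (2 * m).+1)%N.
have w0 (D : {set 'I_n * 'I_n}) : 0 <= p ^+ #|D| * (1 - p) ^+ ('C(n, 2) - #|D|).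
  by rewrite mulr_ge0 ?exprn_ge0.
have step1 : Gnp_prob n p (bad_event R m n) <=
    \sum_(X | small X) \sum_(F | FX X F) Gnp_prob n p (fun D => F \subset D).
  rewrite (eq_bigr (fun X => \sum_(D | simple_edges D) \sum_(F | FX X F && (F \subset D))
     p ^+ #|D| * (1 - p) ^+ ('C(n, 2) - #|D|))); last first.
    move=> X _; rewrite /Gnp_prob (exchange_big_dep (@simple_edges n)) /=; last by move=> ? ? _ /andP[].
    apply: eq_bigr => D sD; apply: eq_bigl => F; by rewrite asboolb sD.
  rewrite exchange_big /= /Gnp_prob big_mkcondr /=.
  apply: ler_sum => D sD; case: asboolP => [bad|_]; last first.
    by apply: sumr_ge0 => X _; apply: sumr_ge0.
  have [X [F [cX FX1 cF FD]]] : exists X : {set 'I_n}, exists F : {set 'I_n * 'I_n},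
      [/\ (#|X| <= (2 * m).+1)%N, F \subset finset.setX X X :&: all_edges n,
      #|F| = #|X|.+1 & F \subset D].
    apply: not_locally_sparse => //; apply/negP => sp.
    exact: (locally_sparse_no_bad_event sD sp bad).
  rewrite (bigD1 X) //= (bigD1 F) /=; last by rewrite /FX FX1 cF eqxx.
  rewrite -addrA lerDl addr_ge0 // ?sumr_ge0 // => X' _; exact: sumr_ge0.
apply: le_trans step1 _.
have step2 X : small X -> \sum_(F | FX X F) Gnp_prob n p (fun D => F \subset D) <=
    c%:R * (lam ^+ (2 * m + 2) / n%:R) * n%:R^-1 ^+ #|X|.
  move=> sX; rewrite (eq_bigr (fun=> p ^+ #|X|.+1)); last first.
    move=> F /andP[FE /eqP <-]; apply: prob_subgraph; apply: (fintype.subset_trans FE).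
    exact: finset.subsetIr.
  have -> : \sum_(F | FX X F) p ^+ #|X|.+1 = #|[set F | FX X F]%SET|%:R * p ^+ #|X|.+1.
    by rewrite sumr_const mulr_natl; congr (_ *+ _); apply: eq_card => F; rewrite inE.
  rewrite -mulrA; apply: ler_pM => //; rewrite ?exprn_ge0 //.
    rewrite ler_nat.
    apply: (@leq_trans #|powerset (finset.setX X X)|).
      apply: subset_leq_card; apply/fintype.subsetP => F; rewrite !inE => /andP[FE _].
      by rewrite (fintype.subset_trans FE) // finset.subsetIl.
    rewrite card_powerset cardsX leq_exp2l // mulnn leq_sqr //.
  rewrite /p expr_div_n -exprVn -mulrA -exprS; apply: ler_wpM2r.
    by rewrite exprn_ge0 // invr_ge0 ltW.
  (* Here [lam >= 1] allows the exponent |X|+1 to be raised to 2m+2. *)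
  by rewrite ler_weXn2l //; move: sX; rewrite /small; lia.
apply: le_trans (ler_sum _ step2) _.
rewrite -mulr_sumr [leRHS]mulrAC; apply: ler_wpM2l.
  by rewrite mulr_ge0 // divr_ge0 // ?exprn_ge0 // ltW.
(* Without the size restriction the sum is (1 + 1/n)^n, which is at most e. *)
apply: (@le_trans _ _ (\sum_(X : {set 'I_n}) n%:R^-1 ^+ #|X|)).
  rewrite big_mkcond; apply: ler_sum => X _; by case: ifP.
rewrite (sum_exprn_card 'I_n) card_ord.
apply: le_trans (_ : expR n%:R^-1 ^+ n <= _).
  by apply: lerXn2r; rewrite ?nnegrE ?expR_ge0 ?expR_ge1Dx // addr_ge0 // invr_ge0 ltW.
by rewrite -expRM_natr mulVf // gt_eqF.
Qed.

(** * Passage to the limit *)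

Lemma Gnp_prob_ge0 (R : realType) n (p : R) (E : {set 'I_n * 'I_n} -> Prop) :
  0 <= p <= 1 -> 0 <= Gnp_prob n p E.
Proof.
move=> /andP[p0 p1]; apply: sumr_ge0 => D _.
by rewrite mulr_ge0 ?exprn_ge0 // subr_ge0.
Qed.

Local Open Scope classical_set_scope.

Theorem theorem1p7 (R : realType) (m : nat) (lam : nat -> R) :
  (1 <= m)%N ->
  (exists2 eps : R, 0 < eps & forall n, 1 + eps <= lam n) ->
  (fun n : nat => lam n / ((n%:R : R) `^ ((2 * m + 2)%:R)^-1)) @ \oo --> (0 : R) ->
  (fun n : nat => Gnp_prob n (lam n / n%:R) (bad_event R m n)) @ \oo --> (0 : R).
Proof.
move=> _ [eps eps0 lam_eps] cvgu.
set u := (fun n : nat => lam n / _) in cvgu.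
pose K : R := (2 ^ ((2 * m).+1 ^ 2))%:R * expR 1.
have K0 : 0 <= K by rewrite mulr_ge0 // expR_ge0.
have lam1 n : 1 <= lam n by apply: le_trans (lam_eps n); rewrite lerDl ltW.
(* The first moment bound is [K] times the power 2m+2 of [u n], and this power is at most [u n] once
   [u n <= 1]. *)
apply: (@squeeze_cvgr _ _ _ _ (fun=> 0) (fun n => K * u n)); last 2 first.
- exact: cvg_cst.
- by rewrite -(mulr0 K); apply: cvgMr cvgu.
near=> n.
have n0 : (0 < n)%N by near: n; exists 1%N.
have n0R : 0 < n%:R :> R by rewrite ltr0n.
have u1 : u n <= 1.
  near: n; have := cvgu; move/cvgr_le; apply; exact: ltr01.
pose r : R := n%:R `^ ((2 * m + 2)%:R)^-1.
have rX : r ^+ (2 * m + 2) = n%:R.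
  by rewrite -powR_mulrn ?powR_ge0 // -powRrM mulVf ?powRr1 ?ler0n //.
have u0 : 0 <= u n by rewrite divr_ge0 ?powR_ge0 // (le_trans _ (lam1 n)).
have uX : lam n ^+ (2 * m + 2) / n%:R = u n ^+ (2 * m + 2).
  by rewrite /u expr_div_n rX.
have uXu : u n ^+ (2 * m + 2) <= u n by rewrite addn2 exprS ler_piMr // exprn_ile1.
(* As [lam n >= 1], it is at most its power 2m+2, which is at most [n] because [u n <= 1]; so
   [lam n / n] is a probability. *)
have lamn : lam n <= n%:R.
  rewrite -[leRHS]mul1r -ler_pdivrMr //.
  apply: le_trans (le_trans uXu u1); rewrite -uX ler_pM2r ?invr_gt0 //.
  by rewrite addn2 exprS ler_peMr ?exprn_ege1 // (le_trans _ (lam1 n)).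
have l0 : 0 <= lam n by apply: le_trans (lam1 n).
rewrite Gnp_prob_ge0 /=; last first.
  by rewrite divr_ge0 // ler_pdivrMr // mul1r.
apply: le_trans (prob_bad_event_le m (lam1 n) lamn) _.
by rewrite uX; apply: ler_wpM2l.
Unshelve. all: by end_near. Qed.
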